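(* For each positive integer $d$ there is a constant $c_d$ such that every $(d,\Delta)$-degenerate graph $H$ with $n$ vertices satisfies $r(H) \leq 2^{c_d\sqrt{\log \Delta}}\, n$. In particular, $r(H) \leq 2^{c_d\sqrt{\log n}}\, n$ for every $d$-degenerate graph $H$ on $n$ vertices.
   Context: The Ramsey number $r(H)$ of a graph $H$ is the least positive integer $N$ such that every two-coloring of the edges of the complete graph $K_N$ contains a monochromatic copy of $H$. A graph is $d$-degenerate if every subgraph has a vertex of degree at most $d$. A graph $H$ is $(d,\Delta)$-degenerate if there is an ordering $v_1,\ldots,v_n$ of its vertices such that for each $v_i$: (1) at most $d$ vertices $v_j$ with $j<i$ are adjacent to $v_i$, and (2) there are at most $\Delta$ subsets $S\subset\{v_1,\ldots,v_i\}$ such that $S=N(v_j)\cap\{v_1,\ldots,v_i\}$ for some neighbor $v_j$ of $v_i$ with $j>i$, where $N(v)$ denotes the set of vertices adjacent to $v$. All logarithms are base $2$.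
   Formalization: The formal statement assumes Δ ≥ 2 and that H has at least one vertex: for Δ = 1 the bound would read r(H) ≤ n, which fails for the star K_{1,3} (n = 4, r = 6), and log 0 is undefined. *)

(* Defs.v *)
From mathcomp Require Import all_boot all_order all_algebra.
From mathcomp Require Import reals exp.
Set Implicit Arguments.
Unset Strict Implicit.
Unset Printing Implicit Defensive.

Import Order.TTheory GRing.Theory Num.Theory.

Record sgraph := SGraph {
  vertex :> finType;
  adj : rel vertex;
  adj_sym : symmetric adj;
  adj_irr : irreflexive adj
}.

Definition nbhd (H : sgraph) (x : H) : {set H} := [set y | adj x y].

Definition initial (H : sgraph) (v : 'I_#|H| -> H) (i : 'I_#|H|) : {set H} :=
  [set v j | j : 'I_#|H| & j <= i].

Definition dDelta_degenerate (d Delta : nat) (H : sgraph) : Prop :=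
  exists v : 'I_#|H| -> H, bijective v /\
    forall i : 'I_#|H|,
      #|[set v j | j : 'I_#|H| & (j < i) && adj (v j) (v i)]| <= d
      /\ #|[set S : {set H} | (S \subset initial v i) &&
             [exists j : 'I_#|H|, [&& i < j, adj (v i) (v j)
                & S == nbhd (v j) :&: initial v i]]]| <= Delta.

(* A subgraph is a vertex set [W] together with a set [F] of edges of [H]
   joining vertices of [W]; it need not be induced.  Only nonempty subgraphs
   can have a vertex of small degree, hence [W != set0]. *)
Definition subgraph (H : sgraph) (W : {set H}) (F : rel H) : Prop :=
  symmetric F /\ forall x y, F x y -> [/\ adj x y, x \in W & y \in W].

Definition degenerate (d : nat) (H : sgraph) : Prop :=
  forall (W : {set H}) (F : rel H), subgraph W F -> W != set0 ->
    exists2 x, x \in W & #|[set y | F x y]| <= d.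

(* The edge of K_N joining [i] and [j] is the pair [set i; j]; the values of a
   coloring on sets that are not of this form with [i != j] play no role. *)
Definition coloring (N : nat) := {ffun {set 'I_N} -> bool}.

Definition mono_copy (H : sgraph) (N : nat) (c : coloring N) : bool :=
  [exists b : bool, exists f : {ffun H -> 'I_N}, injectiveb f &&
     [forall x, forall y, adj x y ==> (c [set f x; f y] == b)]].

Definition arrows (N : nat) (H : sgraph) : bool :=
  [forall c : coloring N, mono_copy H c].

Lemma mono_clique (N : nat) (c : coloring N) (s a b : nat) (A : {set 'I_N}) :
  a + b <= s -> 2 ^ s <= #|A| ->
  exists (e : bool) (S : {set 'I_N}),
    [/\ (if e then a else b) <= #|S|, S \subset A &
        {in S &, forall x y, x != y -> c [set x; y] = e}].
Proof.
elim: s a b A => [|s IHs] a b A hab hA.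
  move: hab; rewrite leqn0 addn_eq0 => /andP[/eqP-> _].
  by exists true, set0; split=> [||x y]; rewrite ?sub0set ?inE.
case: a hab => [|a] hab.
  by exists true, set0; split=> [||x y]; rewrite ?sub0set ?inE.
case: b hab => [|b] hab.
  by exists false, set0; split=> [||x y]; rewrite ?sub0set ?inE.
have /card_gt0P[v vA] : 0 < #|A| by rewrite (leq_trans _ hA) ?expn_gt0.
pose B e := [set x in A :\ v | c [set v; x] == e].
have [e hB] : exists e, 2 ^ s <= #|B e|.
  have hAv : #|B true| + #|B false| = #|A :\ v|.
    rewrite -(cardsID [set x | c [set v; x]] (A :\ v)).
    congr (_ + _); apply: eq_card => x; rewrite !inE.
      by rewrite eqb_id.
    by rewrite eqbF_neg andbC.
  case: (leqP (2 ^ s) #|B true|) => ht; first by exists true.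
  exists false; move: hA; rewrite (cardsD1 v) vA -hAv expnS mul2n -addnn.
  move=> hA; rewrite -(leq_add2l (2 ^ s)); apply: leq_trans hA _.
  by rewrite addnA leq_add2r.
have sB : B e \subset A by apply/subsetP => x; rewrite !inE => /andP[/andP[]].
have vB : v \notin B e by rewrite !inE eqxx.
have cB x : x \in B e -> c [set v; x] = e by rewrite inE => /andP[_ /eqP].
have hs : (if e then a else a.+1) + (if e then b.+1 else b) <= s.
  by move: hab; case: (e); rewrite ?addSn ?addnS ltnS.
have [e' [S [hS SB cS]]] := IHs _ _ _ hs hB.
have [eqe|neqe] := eqVneq e' e; last first.
  exists e'; exists S; split=> //; last exact: subset_trans sB.
  by move: hS neqe; case: (e') (e) => [] [].
subst e'; exists e; exists (v |: S); split.
- rewrite cardsU1 (contra (subsetP SB v) vB) /=.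
  by move: hS; case: (e); rewrite add1n ltnS.
- by rewrite subUset sub1set vA (subset_trans SB sB).
move=> x y /setU1P[->|xS] /setU1P[->|yS] xy.
- by rewrite eqxx in xy.
- exact/cB/(subsetP SB).
- by rewrite setUC; exact/cB/(subsetP SB).
- exact: cS.
Qed.

Lemma ramsey_exists (H : sgraph) : exists N, (0 < N) && arrows N H.
Proof.
exists (2 ^ (#|H| + #|H|)); rewrite expn_gt0 /=; apply/forallP => c.
have [|e [S [hS _ cS]]] :=
  @mono_clique _ c _ #|H| #|H| [set: _] (leqnn _).
  by rewrite cardsT card_ord.
have {}hS : #|H| <= #|S| by case: (e) hS.
pose f (x : H) := enum_val (widen_ord hS (enum_rank x)).
have finj : injective f.
  move=> x y /enum_val_inj /(congr1 val) /= /val_inj.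
  exact: enum_rank_inj.
apply/existsP; exists e; apply/existsP; exists [ffun x => f x].
apply/andP; split.
  by apply/injectiveP => x y; rewrite !ffunE => /finj.
apply/forallP => x; apply/forallP => y; apply/implyP => xy.
rewrite !ffunE cS ?enum_valP // (inj_eq finj).
by apply: contraTneq xy => ->; rewrite adj_irr.
Qed.

Definition ramsey (H : sgraph) : nat := ex_minn (ramsey_exists H).

Definition log2 (R : realType) (x : R) : R := (ln x / ln 2)%R.

(* Main.v *)
Require Import Defs.
From mathcomp Require Import all_boot all_order all_algebra.
From mathcomp Require Import reals exp.
From mathcomp Require Import zify ring lra.

(** Dependent random choice [Fox-Sudakov].  Write t for the square root of
    log Delta, N for a number of order 2 ^ O(t) n and "typical" for "up to a
    proportion 2 ^ -Omega(t ^ 2) of the tuples".  In a two-colouring of K_N,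
    the common neighbourhood of t random vertices, taken inside a set S and in a
    suitable colour, has size at least 2 ^ -O(t) |S|, and its typical d-tuples
    have 2 ^ -O(t) N common neighbours in S.  Iterating yields d + 1 nested sets
    A_i and one colour for which typical tuples from the later sets have many
    common neighbours in A_i.  Intersecting the other sets with the common
    neighbourhood of a random tuple T of A_j, for j from the last index to the
    first, removes the restriction to later sets: tuples inside the common
    neighbourhood of T typically have many common neighbours in A_j, and if a
    tuple extended by T had many common neighbours in A_i, they survive in the
    new A_i.  Finally H, properly coloured with d + 1 colours, is embedded
    greedily along its ordering, the colour class i going to A_i; a new vertex
    has to respect at most (d + 1) Delta distinct constraints. *)

Set Implicit Arguments.
Unset Strict Implicit.
Unset Printing Implicit Defensive.


Lemma leq_wexp2r m n e : m <= n -> m ^ e <= n ^ e.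
Proof. by case: e => // e; rewrite leq_exp2r. Qed.

(** * Counting over sequences of vertices *)

Section SeqSums.
Variable V : finType.
Implicit Types (k l : nat) (s : seq V) (F G : seq V -> nat).

(** Plain sequences with a separate length let concatenation split a sum without casts. Averages
    over random tuples appear as these unnormalised sums. *)
Fixpoint tsum k F : nat :=
  if k is k'.+1 then \sum_(x : V) tsum k' (fun s => F (x :: s)) else F [::].

Lemma leq_tsum k F G :
  (forall s, size s = k -> F s <= G s) -> tsum k F <= tsum k G.
Proof.
elim: k F G => [|k IHk] F G leFG /=; first exact: leFG.
by apply: leq_sum => x _; apply: IHk => s sk; apply: leFG; rewrite /= sk.
Qed.

Lemma eq_tsum k F G :
  (forall s, size s = k -> F s = G s) -> tsum k F = tsum k G.
Proof.
move=> eqFG; apply/eqP; rewrite eqn_leq.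
by rewrite !leq_tsum // => s sk; rewrite eqFG.
Qed.

Lemma tsum_cat k l F :
  tsum (k + l) F = tsum k (fun s => tsum l (fun s' => F (s ++ s'))).
Proof.
elim: k F => [|k IHk] F //=; rewrite ?add0n //.
by apply: eq_bigr => x _; rewrite IHk.
Qed.

Lemma tsum_sum (I : finType) k (F : I -> seq V -> nat) :
  tsum k (fun s => \sum_i F i s) = \sum_i tsum k (F i).
Proof.
elim: k F => [|k IHk] F //=.
by rewrite exchange_big; apply: eq_bigr => x _; rewrite IHk.
Qed.

Lemma tsumD k F G : tsum k (fun s => F s + G s) = tsum k F + tsum k G.
Proof.
elim: k F G => [|k IHk] F G //=.
by rewrite -big_split; apply: eq_bigr => x _; rewrite IHk.
Qed.

Lemma tsum_mull k c F : tsum k (fun s => c * F s) = c * tsum k F.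
Proof.
elim: k F => [|k IHk] F //=.
by rewrite big_distrr; apply: eq_bigr => x _; rewrite IHk.
Qed.

Lemma tsum_exchange k l (F : seq V -> seq V -> nat) :
  tsum k (fun s => tsum l (F s)) = tsum l (fun s' => tsum k (F^~ s')).
Proof.
elim: k F => [|k IHk] F /=; first exact: eq_tsum.
by rewrite tsum_sum; apply: eq_bigr => x _; rewrite IHk.
Qed.

Lemma tsum_all k (A : {set V}) : tsum k (fun s => all (mem A) s) = #|A| ^ k.
Proof.
elim: k => [|k IHk] //=.
rewrite (eq_bigr (fun x => (x \in A) * #|A| ^ k)) => [|x _].
  rewrite -big_distrl /= expnS; congr (_ * _).
  by rewrite -sum1_card [RHS]big_mkcond; apply: eq_bigr => x _; case: (x \in A).
by rewrite -IHk -tsum_mull; apply: eq_tsum => s _; case: (x \in A); rewrite ?mul1n.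
Qed.

(** The first-moment argument behind each random choice of a tuple. *)
Lemma tsum_lt k F G :
  tsum k F < tsum k G -> exists2 s, size s = k & F s < G s.
Proof.
elim: k F G => [|k IHk] F G /= ltFG; first by exists [::].
have [x ltx|leGF] := pickP (fun x =>
    tsum k (fun s => F (x :: s)) < tsum k (fun s => G (x :: s))).
  by have [s sk lts] := IHk _ _ ltx; exists (x :: s); rewrite //= sk.
by case/negP: (negbT (ltnn (\sum_x tsum k (fun s => F (x :: s)))));
  apply: leq_trans ltFG _; apply: leq_sum => x _; rewrite leqNgt leGF.
Qed.

End SeqSums.

(** * Common neighbourhoods and poor tuples *)

Section Common.
Variables (V : finType) (E : rel V).
Hypothesis Esym : symmetric E.
Implicit Types (A B : {set V}) (X Y : seq V).

Definition common X : {set V} := [set y | all (E y) X].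

Lemma common_cat X Y : common (X ++ Y) = common X :&: common Y.
Proof. by apply/setP => y; rewrite !inE all_cat. Qed.

Lemma all_commonC X Y : all (mem (common X)) Y = all (mem (common Y)) X.
Proof.
transitivity (allrel E Y X); first by apply: eq_all => y; rewrite /= inE.
rewrite allrelC; apply: eq_all => x; rewrite /= inE.
by apply: eq_all => y; rewrite Esym.
Qed.

Lemma all_setI A B X : all (mem (A :&: B)) X = all (mem A) X && all (mem B) X.
Proof. by rewrite -all_predI; apply: eq_all => x; rewrite /= inE. Qed.

Lemma all_subset A B X : A \subset B -> all (mem A) X -> all (mem B) X.
Proof. by move=> /subsetP sAB; apply: sub_all => x; apply: sAB. Qed.

Definition poor r B X := #|B :&: common X| * 2 ^ r < #|V|.

(* The proportion is taken among all [k]-sequences of [V], not of [A]: all sets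
   used below have size at least [#|V| / 2 ^ a] with [a * k] smaller than [b]. *)
Definition few_poor r k b A B :=
  tsum k (fun X => all (mem A) X && poor r B X) * 2 ^ b <= #|V| ^ k.

Lemma few_poor_sub r k b A A' B :
  A' \subset A -> few_poor r k b A B -> few_poor r k b A' B.
Proof.
move=> sA; apply: leq_trans; rewrite leq_mul2r; apply/orP; right.
apply: leq_tsum => X _; case: (boolP (all _ _)) => //= XA'.
by rewrite (all_subset sA XA').
Qed.

Lemma poor_sub r B X Y : poor r B X -> poor r B (X ++ Y).
Proof.
apply: leq_ltn_trans; rewrite leq_mul2r common_cat subset_leq_card ?orbT //.
by rewrite setIA subsetIl.
Qed.

(* The sum counts pairs (X, T): for a given [X] only the [T] inside the common
   neighbourhood of [X], fewer than [(#|V| / 2 ^ r) ^ tau] of them, matter. *)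
Lemma poor_pairs r k tau A B :
  tsum tau (fun T => all (mem B) T *
      tsum k (fun X => all (mem (A :&: common T)) X && poor r B X))
    * 2 ^ (r * tau) <= #|A| ^ k * #|V| ^ tau.
Proof.
rewrite mulnC -tsum_mull.
under eq_tsum => T _ do rewrite -!tsum_mull.
rewrite tsum_exchange [leqRHS]mulnC -(tsum_all k A) -tsum_mull.
apply: leq_tsum => X _.
apply: (@leq_trans (2 ^ (r * tau) * (all (mem A) X && poor r B X) *
   tsum tau (fun T => all (mem (B :&: common X)) T))).
  rewrite -tsum_mull; apply: leq_tsum => T _.
  rewrite !all_setI (all_commonC X T) -mulnA !mulnb leq_mul2l; apply/orP; right.
  by case: (all (mem B) T); case: (all (mem A) X); case: (all (mem (common T)) X);
    case: (poor r B X).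
rewrite tsum_all; case: (all (mem A) X); last by rewrite !muln0.
case: (boolP (poor r B X)) => /= [poorX|_]; last by rewrite muln0.
by rewrite !muln1 expnM -expnMn mulnC leq_wexp2r // ltnW.
Qed.

End Common.


(** * Dependent random choice in two colours *)

Section TwoColors.
Variables (V : finType) (col : V -> V -> bool).
Hypothesis colC : forall x y, col x y = col y x.

Definition colrel (e : bool) : rel V := fun x y => col x y == e.

Lemma colrel_sym e : symmetric (colrel e).
Proof. by move=> x y; rewrite /colrel colC. Qed.

(** Double counting: for [v] in [S], the larger of its two colour neighbourhoods contains at least
    half of [S], and all [tau]-sequences inside it have [v] as a common neighbour. *)
Lemma sum_common_lb (S : {set V}) tau :
  #|S| ^ tau.+1 <= 2 ^ tau * \sum_(e : bool)
    tsum tau (fun T => all (mem S) T * #|S :&: common (colrel e) T|).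
Proof.
have sumE e : tsum tau (fun T => all (mem S) T * #|S :&: common (colrel e) T|)
    = \sum_(v in S) #|S :&: [set x | colrel e v x]| ^ tau.
  rewrite [RHS]big_mkcond.
  under [RHS]eq_bigr => v _ do rewrite -tsum_all -mulnbl -tsum_mull.
  rewrite -tsum_sum; apply: eq_tsum => T _.
  rewrite -sum1_card big_mkcond big_distrr /=; apply: eq_bigr => v _.
  rewrite all_setI !inE.
  have -> : all (mem [set x | colrel e v x]) T = all (colrel e v) T.
    by apply: eq_all => x; rewrite /= inE.
  by case: (v \in S); case: (all (mem S) T); case: (all (colrel e v) T).
under eq_bigr => e _ do rewrite sumE.
rewrite exchange_big big_distrr /= expnS -sum_nat_const.
apply: leq_sum => v _; rewrite big_bool /=.
have cardS : #|S| = #|S :&: [set x | colrel true v x]| +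
                    #|S :&: [set x | colrel false v x]|.
  rewrite -(cardsID [set x | colrel true v x] S); congr (_ + _).
  by apply: eq_card => x; rewrite !inE /colrel; case: (col v x); rewrite andbC.
rewrite mulnDr -!expnMn cardS.
set p := #|_|; set q := #|_|.
case: (leqP p q) => [le_pq|/ltnW le_qp].
  by apply: leq_trans (leq_addl _ _); apply: leq_wexp2r; lia.
by apply: leq_trans (leq_addr _ _); apply: leq_wexp2r; lia.
Qed.

Lemma dependent_random_choice (S : {set V}) a r k b tau :
  0 < #|V| -> #|V| <= 2 ^ a * #|S| -> b + tau + 3 + a * tau <= r * tau ->
  exists (e : bool) (W : {set V}),
    [/\ W \subset S, #|S| <= #|W| * 2 ^ (tau + 3) &
        few_poor (colrel e) r k b W S].
Proof.
move=> V_gt0 leVS hb; set n := #|S|.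
have n_gt0 : 0 < n by rewrite /n; case: #|S| leVS => //; lia.
pose w e T := #|S :&: common (colrel e) T|.
pose g e T := tsum k (fun X =>
  all (mem (S :&: common (colrel e) T)) X && poor (colrel e) r S X).
pose P := 2 ^ (tau + 3) * n ^ k.
pose R := n * 2 ^ (b + tau + 3).
have gle e : 2 ^ (b + tau + 3) * tsum tau (fun T => all (mem S) T * g e T)
    <= n ^ (k + tau).
  have := poor_pairs (@colrel_sym e) r k tau S S.
  rewrite -/(g e) -/n => hg.
  have hV : #|V| ^ tau <= 2 ^ (a * tau) * n ^ tau.
    by rewrite expnM -expnMn leq_wexp2r.
  rewrite -(leq_pmul2l (_ : 0 < 2 ^ (a * tau))) ?expn_gt0 //.
  apply: (@leq_trans (n ^ k * #|V| ^ tau)); last first.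
    by rewrite expnD mulnCA leq_mul2l hV orbT.
  apply: leq_trans hg.
  rewrite mulnA -expnD mulnC leq_mul2l leq_exp2l // addnC hb orbT //.
(* One inequality serves both requirements: dropping [g e T * R] bounds [W] from below, dropping
   [n ^ k.+1] bounds the number of poor tuples. Summing its negation would give 8 <= 4, the 8 coming
   from [tau + 3] and the 4 from two colours with two terms each. *)
have [e lte] : exists e,
    tsum tau (fun T => all (mem S) T * (n ^ k.+1 + g e T * R)) <
    tsum tau (fun T => all (mem S) T * (w e T * P)).
  apply/existsP; apply: contraT; rewrite negb_exists => /forallP no.
  have : \sum_e tsum tau (fun T => all (mem S) T * (w e T * P)) <=
    \sum_e tsum tau (fun T => all (mem S) T * (n ^ k.+1 + g e T * R)).
    by apply: leq_sum => e _; rewrite leqNgt no.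
  have -> : \sum_e tsum tau (fun T => all (mem S) T * (w e T * P)) =
     P * \sum_e tsum tau (fun T => all (mem S) T * w e T).
    rewrite big_distrr /=; apply: eq_bigr => e _; rewrite -tsum_mull.
    by apply: eq_tsum => T _; rewrite mulnA mulnC.
  have -> : \sum_e tsum tau (fun T => all (mem S) T * (n ^ k.+1 + g e T * R)) =
     \sum_e (n ^ k.+1 * n ^ tau + R * tsum tau (fun T => all (mem S) T * g e T)).
    apply: eq_bigr => e _; rewrite -(tsum_all tau S) -!tsum_mull -tsumD.
    by apply: eq_tsum => T _; rewrite mulnDr mulnA [X in _ + X]mulnC [X in X + _]mulnC.
  have := sum_common_lb S tau; rewrite -/n.
  set ww := \sum_e tsum _ _ => hw hle.
  have : P * ww <= \sum_(e : bool) (2 * n ^ (k + tau).+1).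
    apply: leq_trans hle _; apply: leq_sum => e _.
    rewrite -expnD addSn mul2n -addnn leq_add2l /R -mulnA expnS.
    by rewrite leq_mul2l gle orbT.
  rewrite big_const card_bool /= addn0.
  have : 8 * n ^ k * n ^ tau.+1 <= P * ww.
    have -> : P * ww = 8 * n ^ k * (2 ^ tau * ww) by rewrite /P expnD; ring.
    by rewrite leq_mul2l hw orbT.
  rewrite -mulnA -expnD addnS.
  have : 0 < n ^ (k + tau).+1 by rewrite expn_gt0 n_gt0.
  by lia.
have [T _] := tsum_lt lte.
case: (all (mem S) T); rewrite ?mul0n // !mul1n => ltT.
exists e, (S :&: common (colrel e) T); split.
- exact: subsetIl.
- rewrite -/(w e T) -(leq_pmul2r (_ : 0 < n ^ k)) ?expn_gt0 ?n_gt0 //.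
  rewrite -mulnA -/P -/n -expnS.
  by apply: leq_trans (ltnW ltT); rewrite leq_addr.
have leVn : n ^ k <= #|V| ^ k by rewrite leq_wexp2r // max_card.
apply: leq_trans leVn; rewrite -/(g e T).
rewrite -(leq_pmul2r (_ : 0 < n * 2 ^ (tau + 3))); last first.
  by rewrite muln_gt0 n_gt0 expn_gt0.
have -> : g e T * 2 ^ b * (n * 2 ^ (tau + 3)) = g e T * R.
  by rewrite /R -addnA [in RHS]expnD; ring.
apply: leq_trans (leq_trans (leq_addl _ _) (ltnW ltT)) _.
rewrite /P mulnA mulnC leq_mul2l leq_mul2r.
by rewrite (subset_leq_card (subsetIl _ _)) !orbT.
Qed.

(** The induction of [mono_clique] with sets in place of vertices: [S] is put in front of a chain
    found inside [W]. Each of at most [s] rounds adds [tau + 3] to the density exponent, and [a0]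
    bounds the total. *)
Lemma mono_chain k b tau a0 r s a p q (S : {set V}) :
  0 < #|V| -> #|V| <= 2 ^ a * #|S| -> p + q <= s ->
  a + s * (tau + 3) <= a0 -> b + tau + 3 + a0 * tau <= r * tau ->
  exists (e : bool) (A : nat -> {set V}),
    let m := if e then p else q in
    forall i, i < m -> [/\ A i \subset S, #|V| <= 2 ^ a0 * #|A i| &
      exists2 W : {set V}, few_poor (colrel e) r k b W (A i) &
        forall j, i < j < m -> A j \subset W].
Proof.
move=> V_gt0; elim: s a p q S => [|s IHs] a p q S leVS hpq ha hr.
  move: hpq; rewrite leqn0 addn_eq0 => /andP[/eqP-> _].
  by exists true, (fun=> S) => /= i.
case: p hpq => [|p] hpq; first by exists true, (fun=> S) => /= i.
case: q hpq => [|q] hpq; first by exists false, (fun=> S) => /= i.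
have hr' : b + tau + 3 + a * tau <= r * tau.
  by apply: leq_trans hr; rewrite leq_add2l leq_mul2r; apply/orP; right; lia.
have [e [W [sWS leSW fewW]]] := @dependent_random_choice S a r k b tau V_gt0 leVS hr'.
have leVW : #|V| <= 2 ^ (a + (tau + 3)) * #|W|.
  by apply: leq_trans leVS _; rewrite expnD -mulnA leq_mul2l [_ * #|W|]mulnC leSW orbT.
have hs : (if e then p else p.+1) + (if e then q.+1 else q) <= s.
  by move: hpq; case: (e); lia.
have [|e' [A HA]] := IHs _ _ _ W leVW hs _ hr.
  by move: ha; rewrite mulSn; lia.
(* In the colour other than [e] the required length was not reduced, so the recursive chain already
   suffices. *)
have [eqe|neqe] := eqVneq e' e; last first.
  exists e', A => m i im.
  have [|sA cA HW] := HA i.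
    by move: im neqe; rewrite /m; case: (e') (e) => [] [].
  split=> //; first exact: subset_trans sWS.
  case: HW => W' fW' sW'; exists W' => // j; move: (sW' j) neqe.
  by rewrite /m; case: (e') (e) => [] [].
subst e'; exists e, (fun i => if i is i'.+1 then A i' else S) => m.
have mS : m = (if e then (if e then p else p.+1) else (if e then q.+1 else q)).+1.
  by rewrite /m; case: (e).
rewrite mS => -[|i] im.
  split=> //.
    by apply: leq_trans leVS _; rewrite leq_mul2r leq_exp2l //; apply/orP; right; lia.
  by exists W => // -[//|j] /andP[_ jm]; have [] := HA j jm.
have [sA cA [W' fW' sW']] := HA i im.
split=> //; first exact: subset_trans sWS.
by exists W' => // -[//|j]; exact: sW'.
Qed.

End TwoColors.


(** * Removing the restriction to later sets *)

Section Spread.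
Variables (V : finType) (E : rel V) (q : nat).
Hypotheses (Esym : symmetric E) (V_gt0 : 0 < #|V|).
Implicit Types (A : 'I_q -> {set V}) (L : rel 'I_q).

(** [L] records the pairs already secured: tuples drawn from this union should typically have many
    common neighbours in [A i]. *)
Definition pool L A i : {set V} := \bigcup_(j | L i j) A j.

(* [T] is a [tau]-sequence of [A j0], and [A' i = A i :&: common T] for [i] other
   than [j0].  If [X] is poor for [A' i] then [X ++ T] is poor for [A i]; the
   poor [X] for [A j0] inside [common T] are few on average by [poor_pairs]. *)
Lemma spread_step L (j0 : 'I_q) A rho rho' k tau b b' :
  (forall i, i != j0 -> L i j0) ->
  (forall i, #|V| <= 2 ^ rho * #|A i|) ->
  (forall i, i != j0 -> few_poor E rho (k + tau) b (pool L A i) (A i)) ->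
  rho <= rho' -> b' + rho * tau + q <= b -> b' + rho * tau + q <= rho' * tau ->
  rho * k < b' ->
  exists A', (forall i, #|V| <= 2 ^ rho' * #|A' i|) /\
    forall i, few_poor E rho' k b'
      (pool (fun i j => if i == j0 then j != i else L i j) A' i) (A' i).
Proof.
move=> Lj0 leVA fewA le_rho hb hb' hk.
pose L' (i j : 'I_q) := if i == j0 then j != i else L i j; rewrite -/L'.
pose A' T i := if i == j0 then A i else A i :&: common E T.
pose g i T := tsum k (fun X => all (mem (pool L' (A' T) i)) X && poor E rho' (A' T i) X).
(* In the exponent, [rho * tau] pays for drawing [T] from [A j0] instead of the whole vertex set,
   [q] for the sum over all indices [i] (as [q < 2 ^ q]), and [b'] is what remains. *)
have gle i : tsum tau (fun T => all (mem (A j0)) T * g i T) *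
    2 ^ (b' + rho * tau + q) <= #|V| ^ (k + tau).
  have [ij|ij] := eqVneq i j0.
    apply: (@leq_trans (tsum tau (fun T => all (mem (A j0)) T * tsum k (fun X =>
        all (mem ([set: V] :&: common E T)) X && poor E rho' (A j0) X))
        * 2 ^ (rho' * tau))).
      apply: leq_mul; last by rewrite leq_exp2l.
      apply: leq_tsum => T _; rewrite leq_mul2l; apply/orP; right.
      apply: leq_tsum => X _.
      case: (boolP (all (mem (pool _ _ _)) X)) => //= allX.
      rewrite (_ : all _ _) /= ?ij /A' ?eqxx //.
      apply: all_subset allX; apply/bigcupsP => j; rewrite /L' ij eqxx => ji.
      by rewrite /A' (negPf ji) setTI subsetIr.
    by have := poor_pairs Esym rho' k tau [set: V] (A j0); rewrite cardsT expnD.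
  apply: leq_trans (fewA i ij).
  apply: leq_mul; last by rewrite leq_exp2l.
  rewrite tsum_cat tsum_exchange; apply: leq_tsum => T _.
  rewrite -tsum_mull; apply: leq_tsum => X _.
  case: (boolP (all (mem (A j0)) T)) => //= allT; rewrite mul1n.
  case: (boolP (all (mem (pool _ _ _)) X)) => //= allX.
  case: (boolP (poor _ _ _ _)) => //= poorX.
  rewrite all_cat (all_subset _ allT) ?bigcup_sup ?Lj0 // andbT.
  rewrite (all_subset _ allX) /=; last first.
    apply/bigcupsP => j; rewrite /L' (negPf ij) /A' => Lij.
    by apply: subset_trans (bigcup_sup j Lij); case: ifP => // _; exact: subsetIl.
  rewrite (_ : poor _ _ _ _) //; apply: leq_ltn_trans poorX.
  apply: leq_mul; last by rewrite leq_exp2l.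
  by rewrite /A' (negPf ij) common_cat [common E X :&: _]setIC setIA.
have leVn : #|V| ^ tau <= 2 ^ (rho * tau) * #|A j0| ^ tau.
  by rewrite expnM -expnMn leq_wexp2r.
have A0_gt0 : 0 < #|A j0| by move: (leVA j0); case: #|A j0|; lia.
have [T _] : exists2 T, size T = tau &
    all (mem (A j0)) T * (\sum_i g i T * 2 ^ b') < all (mem (A j0)) T * #|V| ^ k.
  apply: tsum_lt.
  have -> : tsum tau (fun T => all (mem (A j0)) T * #|V| ^ k)
      = #|V| ^ k * #|A j0| ^ tau.
    by rewrite -tsum_all -tsum_mull; apply: eq_tsum => T _; rewrite mulnC.
  have -> : tsum tau (fun T => all (mem (A j0)) T * (\sum_i g i T * 2 ^ b')) =
      \sum_i tsum tau (fun T => all (mem (A j0)) T * g i T) * 2 ^ b'.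
    rewrite -big_distrl /= [RHS]mulnC -tsum_sum -tsum_mull; apply: eq_tsum => T _.
    by rewrite -big_distrl -big_distrr /= mulnA mulnC.
  rewrite -(ltn_pmul2r (_ : 0 < 2 ^ (rho * tau + q))) ?expn_gt0 //.
  apply: (@leq_ltn_trans (q * #|V| ^ (k + tau))).
    rewrite -[X in _ <= X * _](card_ord q) -sum_nat_const big_distrl /=.
    by apply: leq_sum => i _; rewrite -mulnA -expnD addnA.
  apply: (@leq_ltn_trans (q * (#|V| ^ k * (2 ^ (rho * tau) * #|A j0| ^ tau)))).
    by rewrite expnD !leq_mul2l leVn !orbT.
  have -> : #|V| ^ k * #|A j0| ^ tau * 2 ^ (rho * tau + q) =
            2 ^ q * (#|V| ^ k * (2 ^ (rho * tau) * #|A j0| ^ tau)).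
    by rewrite expnD [RHS]mulnC -!mulnA; congr (_ * _); rewrite mulnCA.
  rewrite ltn_pmul2r; first by rewrite ltn_expl.
  by rewrite !muln_gt0 !expn_gt0 V_gt0 A0_gt0.
case: (boolP (all _ _)) => allT; last by rewrite !mul0n.
rewrite !mul1n => ltT.
have fewA' i : g i T * 2 ^ b' <= #|V| ^ k.
  by apply: leq_trans (ltnW ltT); rewrite (bigD1 i) //= leq_addr.
exists (A' T); split=> // i.
have [ij|ij] := eqVneq i j0.
  rewrite /A' ij eqxx; apply: leq_trans (leVA j0) _.
  by rewrite leq_mul2r leq_exp2l // le_rho orbT.
(* If [A' T i] were too small, every [k]-sequence of [A j0] would be poor for it. These alone form a
   proportion of at least [2 ^- (rho * k)], more than the [2 ^- b'] allowed. *)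
rewrite leqNgt; apply/negP => small.
have : #|A j0| ^ k * 2 ^ b' <= #|V| ^ k.
  apply: leq_trans (fewA' i); rewrite leq_mul2r; apply/orP; right.
  rewrite -tsum_all; apply: leq_tsum => X _.
  case: (boolP (all _ X)) => //= allX.
  rewrite (all_subset _ allX) /=; last first.
    have L'i : L' i j0 by rewrite /L' (negPf ij) Lj0.
    by have := bigcup_sup (F := A' T) j0 L'i; rewrite {1}/A' eqxx.
  rewrite (_ : poor _ _ _ _) //; apply: leq_ltn_trans small.
  by rewrite mulnC leq_mul2l subset_leq_card ?orbT ?subsetIl.
apply/negP; rewrite -ltnNge.
apply: (@leq_ltn_trans (2 ^ (rho * k) * #|A j0| ^ k)).
  by rewrite expnM -expnMn leq_wexp2r.
by rewrite mulnC ltn_pmul2l ?expn_gt0 ?A0_gt0 // ltn_exp2l.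
Qed.

End Spread.


Section SpreadAll.
Variables (V : finType) (E : rel V) (q : nat).
Hypotheses (Esym : symmetric E) (V_gt0 : 0 < #|V|).

Lemma pool_sub (L1 L2 : rel 'I_q) (A : 'I_q -> {set V}) i :
  (forall j, L1 i j -> L2 i j) -> pool L1 A i \subset pool L2 A i.
Proof.
by move=> sL; apply/bigcupsP => j /sL Lij; apply: bigcup_sup.
Qed.

Lemma spread_all (A0 : 'I_q -> {set V}) (rho tau b kk : nat -> nat) :
  (forall l, l < q ->
     [/\ kk l = kk l.+1 + tau l, rho l <= rho l.+1,
         b l.+1 + rho l * tau l + q <= b l,
         b l.+1 + rho l * tau l + q <= rho l.+1 * tau l &
         rho l * kk l.+1 < b l.+1]) ->
  (forall i, #|V| <= 2 ^ rho 0 * #|A0 i|) ->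
  (forall i, few_poor E (rho 0) (kk 0) (b 0)
     (pool (fun i j : 'I_q => i < j) A0 i) (A0 i)) ->
  exists A : 'I_q -> {set V}, forall i, #|V| <= 2 ^ rho q * #|A i| /\
    few_poor E (rho q) (kk q) (b q) (pool (fun i j => j != i) A i) (A i).
Proof.
move=> params leA0 fewA0.
(* After [l] stages the last [l] indices are complete and the others still see only later ones. The
   next index [q - l.+1] is then seen by all others, as [spread_step] requires; hence the order from
   last to first. *)
pose L l (i j : 'I_q) := (i < j) || ((q - l <= i) && (j != i)).
have iter l : l <= q -> exists A : 'I_q -> {set V},
    (forall i, #|V| <= 2 ^ rho l * #|A i|) /\
    forall i, few_poor E (rho l) (kk l) (b l) (pool (L l) A i) (A i).
  elim: l => [|l IHl] lq.
    exists A0; split=> // i; apply: few_poor_sub (fewA0 i); apply: pool_sub => j.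
    by rewrite /L subn0 [q <= i]leqNgt ltn_ord orbF.
  have [A [leA fewA]] := IHl (ltnW lq).
  have [kkE le_rho hb hb' hk] := params l lq.
  have j0P : q - l.+1 < q by lia.
  pose j0 := Ordinal j0P.
  have [i|i _|A' [leA' fewA']] :=
    spread_step Esym V_gt0 (L := L l) (j0 := j0) _ leA _ le_rho hb hb' hk.
  - by rewrite /L -!val_eqE /= !eqn_leq; move: (nat_of_ord i) => m; lia.
  - by rewrite -kkE.
  exists A'; split=> // i; apply: few_poor_sub (fewA' i); apply: pool_sub => j.
  by rewrite /L -!val_eqE /= !eqn_leq; case: ifP; lia.
have [A [leA fewA]] := iter q (leqnn q).
exists A => i; split=> //; apply: few_poor_sub (fewA i); apply: pool_sub => j.
by rewrite /L subnn => ->; rewrite orbT.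
Qed.

End SpreadAll.

(** * Choice of the parameters *)

Section MonoSpread.
Variables (q d t : nat).
Hypothesis t_gt0 : 0 < t.

(* Stage [l] of [spread_all] uses [rho l = base ^ l * base ^ (q + 4) * t] and
   [tau l = base ^ (q.+1 - l) * t], so that [beta = rho l * tau l] does not depend
   on [l]; the exponent [b l] starts at [2 * q.+1 * beta] and loses [2 * beta] per
   stage, ending at [2 * beta].  Then [depth * t] is the final [rho] and
   [expo * t ^ 2] is [beta]. *)
Definition base := 10 * q.+1 + d.
Definition depth := base ^ (q + (q + 4)).
Definition expo := base ^ (q.+1 + (q + 4)).

Lemma mono_spread (V : finType) (col : V -> V -> bool) :
  (forall x y, col x y = col y x) -> 0 < #|V| ->
  exists (e : bool) (A : 'I_q -> {set V}), forall i,
    #|V| <= 2 ^ (depth * t) * #|A i| /\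
    few_poor (colrel col e) (depth * t) d (2 * (expo * (t * t)))
      (pool (fun i j => j != i) A i) (A i).
Proof.
move=> colC V_gt0.
pose D := base; pose x := D ^ (q + 4).
have D_gt0 : 0 < D by rewrite /D /base; lia.
pose beta := D ^ q.+1 * x * (t * t).
pose rho l := D ^ l * x * t.
pose tau l := D ^ (q.+1 - l) * t.
pose b l := 2 * (q.+1 - l) * beta.
(* Tuples of stage [l] must hold the final [d] entries and the samples of all stages still to
   come. *)
pose kk l := d + \sum_(l <= j < q) tau j.
have tauS l : l <= q -> tau l = D * tau l.+1.
  by move=> lq; rewrite /tau mulnA -expnS; congr (D ^ _ * _); lia.
have rhoS l : rho l.+1 = D * rho l by rewrite /rho !mulnA -expnS.
have rhotau l : l <= q -> rho l * tau l = beta.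
  move=> lq; rewrite /rho /tau /beta.
  have -> : D ^ q.+1 = D ^ l * D ^ (q.+1 - l) by rewrite -expnD; congr (D ^ _); lia.
  by move: (D ^ l) (D ^ (q.+1 - l)) => y z; ring.
have beta_gt : q < beta.
  apply: (@leq_trans D); first by rewrite /D /base; lia.
  rewrite /beta expnS -!mulnA leq_pmulr // !muln_gt0 t_gt0 /x !expn_gt0 D_gt0 //.
have kkS l : l < q -> kk l = kk l.+1 + tau l.
  by move=> lq; rewrite /kk big_ltn // [tau l + _]addnC addnA.
(* The [tau l] shrink by a factor [D] per stage, so [kk l] is governed by its first term, as in a
   geometric sum; at the end [d <= tau q]. *)
have kk_le m : m <= q -> kk (q - m) <= 2 * tau (q - m).
  elim: m => [|m IHm] mq.
    rewrite subn0 /kk big_geq // addn0 /tau subSnn expn1.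
    have : D <= D * t by rewrite leq_pmulr.
    by rewrite /D /base; lia.
  have mq' : q - m.+1 < q by lia.
  rewrite kkS // -subSn // subSS tauS; last by lia.
  rewrite -subSn // subSS; have := IHm (ltnW mq).
  move: (tau _) (kk _) => y z; have : 4 <= D by rewrite /D /base; lia.
  by nia.
have params l : l < q ->
     [/\ kk l = kk l.+1 + tau l, rho l <= rho l.+1,
         b l.+1 + rho l * tau l + q <= b l,
         b l.+1 + rho l * tau l + q <= rho l.+1 * tau l &
         rho l * kk l.+1 < b l.+1].
  move=> lq; rewrite rhotau ?(ltnW lq) // rhoS -mulnA rhotau ?(ltnW lq) //.
  split.
  - exact: kkS.
  - by rewrite leq_pmull.
  - have -> : b l = b l.+1 + 2 * beta.
      by rewrite /b -mulnDl; congr (_ * _); lia.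
    by lia.
  - have : b l.+1 <= 2 * q * beta.
      by rewrite /b leq_mul2r; apply/orP; right; lia.
    have : (2 * q + 2) * beta <= D * beta.
      by rewrite leq_mul2r; apply/orP; right; rewrite /D /base; lia.
    by rewrite mulnDl; lia.
  - apply: (@leq_ltn_trans beta).
      rewrite -(rhotau l (ltnW lq)) leq_mul2l; apply/orP; right.
      rewrite tauS ?(ltnW lq) //.
      have := kk_le (q - l.+1) (leq_subr _ _).
      have -> : q - (q - l.+1) = l.+1 by lia.
      have : 2 * tau l.+1 <= D * tau l.+1.
        by rewrite leq_mul2r; apply/orP; right; rewrite /D /base; lia.
      by lia.
    apply: (@leq_trans (2 * beta)); first by lia.
    by rewrite /b leq_mul2r; apply/orP; right; lia.
(* The sample size for [mono_chain]: then [rho 0 * tau'] equals [D * beta], which exceeds [b 0] by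
   enough to cover the other terms. *)
pose tau' := D ^ (q + 2) * t.
have tau'_gt0 : 0 < tau' by rewrite muln_gt0 expn_gt0 D_gt0.
have rho0 : rho 0 = D * D * tau'.
  rewrite /rho /tau' /x expn0 mul1n mulnA -[D * D * _]mulnA -!expnS.
  by congr (D ^ _ * _); lia.
have betaE : beta = D * (tau' * tau').
  rewrite /beta /tau' /x.
  have -> : D ^ (q + 4) = D ^ (q + 2) * (D * D) by rewrite mulnA -!expnSr; congr (D ^ _); lia.
  have -> : D ^ (q + 2) = D ^ q.+1 * D by rewrite -expnSr; congr (D ^ _); lia.
  by move: (D ^ q.+1) => y; ring.
(* Each of the [q + q] rounds of [mono_chain] costs [tau' + 3 <= 4 * tau']. *)
pose a0 := 8 * q * tau'.
have [|||e [A HA]] := @mono_chain V col colC (kk 0) (b 0) tau' a0 (rho 0)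
    (q + q) 0 q q [set: V] V_gt0 _ (leqnn _).
- by rewrite cardsT mul1n.
- by rewrite add0n /a0; nia.
- have -> : rho 0 * tau' = D * beta by rewrite rho0 betaE; ring.
  have -> : b 0 = (2 * q + 2) * beta by rewrite /b subn0; congr (_ * _); lia.
  have h1 : a0 * tau' <= beta.
    rewrite /a0 betaE -mulnA leq_mul2r; apply/orP; right.
    by rewrite /D /base; lia.
  have h2 : tau' + 3 <= beta.
    rewrite betaE; have : 4 <= D by rewrite /D /base; lia.
    by nia.
  have : (2 * q + 4) * beta <= D * beta.
    by rewrite leq_mul2r; apply/orP; right; rewrite /D /base; lia.
  by rewrite !mulnDl; lia.
move: HA; rewrite if_same => HA.
have [i|i|A' HA'] := @spread_all V (colrel col e) q (colrel_sym colC e) V_gt0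
    (fun i => A i) rho tau b kk params.
- have [_ leA _] := HA i (ltn_ord i).
  apply: leq_trans leA _; rewrite leq_mul2r; apply/orP; right.
  rewrite leq_exp2l // rho0 /a0 leq_mul2r; apply/orP; right.
  by rewrite /D /base; nia.
- have [_ _ [W fewW sW]] := HA i (ltn_ord i).
  apply: few_poor_sub fewW; apply/bigcupsP => j ij.
  by apply: sW; rewrite ij ltn_ord.
exists e, A' => i; have := HA' i.
have -> : kk q = d by rewrite /kk big_geq // addn0.
have -> : rho q = depth * t by rewrite /rho /x /depth -expnD.
by have -> : b q = 2 * (expo * (t * t))
  by rewrite /b subSnn muln1 /beta /x /expo -expnD.
Qed.

End MonoSpread.


Lemma leq_card_bigcup (T : finType) (I : Type) (s : seq I) (F : I -> {set T}) :
  #|\bigcup_(i <- s) F i| <= \sum_(i <- s) #|F i|.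
Proof.
elim/big_rec2: _ => [|i m S _ leSm]; first by rewrite cards0.
by apply: leq_trans (leq_card_setU _ _) _; rewrite leq_add2l.
Qed.

(** * Dead and living tuples *)

Section Dead.
Variables (V : finType) (e : nat) (P : seq V -> bool).

(* A living tuple can be prolonged by all but a [2 ^- e] proportion of the
   vertices, and with no slot left it satisfies [~~ P]. *)
Fixpoint dead k (X : seq V) : bool :=
  if k is k'.+1 then #|V| <= 2 ^ e * #|[set x | dead k' (rcons X x)]| else P X.

(** At each of the [k] slots at least a [2 ^- e] proportion of the vertices keeps the tuple dead,
    and these proportions multiply. *)
Lemma dead_count k X :
  dead k X -> #|V| ^ k <= tsum k (fun Y => P (X ++ Y)) * 2 ^ (e * k).
Proof.
elim: k X => [|k IHk] X /=; first by rewrite cats0 muln0 => ->.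
set D := [set x | _] => leD.
apply: (@leq_trans (2 ^ e * (#|D| * #|V| ^ k))).
  by rewrite expnS mulnA leq_mul2r leD orbT.
rewrite mulnS expnD [leqRHS]mulnCA leq_mul2l; apply/orP; right.
rewrite -sum_nat_const big_distrl /= [leqLHS]big_mkcond; apply: leq_sum => x _.
case: ifP => //; rewrite inE => /IHk.
by under eq_tsum => Y _ do rewrite cat_rcons.
Qed.

Lemma dead_ext (B : {set V}) k X :
  (forall Y x, P Y -> x \in B -> P (rcons Y x)) -> #|V| <= 2 ^ e * #|B| ->
  P X -> dead k X.
Proof.
move=> PB leB; elim: k X => //= k IHk X PX.
apply: leq_trans leB _; rewrite leq_mul2l subset_leq_card ?orbT //.
by apply/subsetP => x xB; rewrite inE; apply: IHk; apply: PB.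
Qed.

End Dead.

Definition upd (T : Type) (f : nat -> T) m y k := if k == m then y else f k.

(** * The greedy embedding *)

Section Embedding.
Variables (V : finType) (E : rel V) (q d rho b e : nat) (A : 'I_q -> {set V}).
Hypotheses (Esym : symmetric E) (V_gt0 : 0 < #|V|) (q_gt1 : 1 < q).
Let poolA c := pool (fun i j => j != i) A c.
Hypotheses (leA : forall c, #|V| <= 2 ^ rho * #|A c|)
  (fewA : forall c, few_poor E rho d b (poolA c) (A c))
  (lt_ed : e * d < b) (le_rho : rho <= e).

Variables (n Delta : nat) (R : rel nat) (chi : nat -> 'I_q).
(** The trace of [j] before [i] as an increasing list: equal traces are equal lists, and mapping the
    embedding over it gives the tuple already fixed for [j]. *)
Definition back j i := [seq k <- iota 0 i | R k j].
(** Divided by [2 ^ e], [room] says that the used vertices and [q * Delta] sets of proportion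
    [2 ^- e] cannot exhaust a set of proportion [2 ^- rho]. *)
Hypotheses
  (chiP : forall i j, i < j < n -> R i j -> chi i != chi j)
  (size_back : forall j, j < n -> size (back j j) <= d)
  (size_traces : forall i, i < n ->
     size (undup [seq back j i.+1 | j <- iota 0 n & (i < j) && R i j]) <= Delta)
  (room : n * 2 ^ e + q * Delta * #|V| < #|V| * 2 ^ (e - rho)).

Let P c X := all (mem (poolA c)) X && poor E rho (A c) X.

Lemma back_lt j i k : k \in back j i -> k < i.
Proof. by rewrite mem_filter mem_iota => /andP[]. Qed.

Lemma backS j i : back j i.+1 = if R i j then rcons (back j i) i else back j i.
Proof. by rewrite /back -addn1 iotaD filter_cat /= add0n; case: (R i j); rewrite ?cats1 ?cats0. Qed.

Lemma leq_size_back j i i' : i <= i' -> size (back j i) <= size (back j i').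
Proof. by move=> /subnKC <-; rewrite /back iotaD filter_cat size_cat leq_addr. Qed.

Lemma map_upd_back (f : nat -> V) m y j : map (upd f m y) (back j m) = map f (back j m).
Proof. by apply/eq_in_map => k /back_lt km; rewrite /upd ltn_eqF. Qed.

(** Appending a vertex of another [A c'] keeps the tuple in the pool and poor, and [A c'] has
    proportion at least [2 ^- rho], hence at least [2 ^- e]. *)
Lemma poor_dead c k X : P c X -> dead e (P c) k X.
Proof.
have [c' cc'] : exists c', c' != c.
  have [c0|c0] := eqVneq (val c) 0.
    by exists (Ordinal q_gt1); rewrite -val_eqE c0.
  by exists (Ordinal (ltnW q_gt1)); rewrite -val_eqE eq_sym.
apply: (dead_ext (B := A c')).
  move=> Y x /andP[allY poorY] xA; rewrite /P all_rcons allY /= -cats1 poor_sub //.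
  by rewrite !andbT; apply/bigcupP; exists c'.
by apply: leq_trans (leA c') _; rewrite leq_mul2r leq_exp2l // le_rho orbT.
Qed.

(** The last clause keeps the later vertices embeddable. Free slots are counted up to [d] even if
    [j] has fewer earlier neighbours; [poor_dead] makes the surplus harmless. *)
Definition partial_embedding m (f : nat -> V) :=
  [/\ forall i, i < m -> f i \in A (chi i),
      forall i j, i < j < m -> f i != f j,
      forall i j, i < j < m -> R i j -> E (f i) (f j) &
      forall j, m <= j < n ->
        ~~ dead e (P (chi j)) (d - size (back j m)) (map f (back j m))].

Lemma embedding_next m f : m < n -> partial_embedding m f ->
  exists y, [/\ y \in A (chi m), forall i, i < m -> f i != y,
    forall i, i < m -> R i m -> E (f i) y &
    forall j, m < j < n -> R m j ->
      ~~ dead e (P (chi j)) (d - size (back j m.+1))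
           (map (upd f m y) (back j m.+1))].
Proof.
move=> mn [fA finj fE alive].
pose X := map f (back m m).
(* The images of the earlier neighbours of [m] lie in the pool, since [chi] is proper. Were they
   poor, their tuple would be dead. *)
have rich : #|V| <= #|A (chi m) :&: common E X| * 2 ^ rho.
  have := alive m; rewrite leqnn mn => /(_ isT).
  apply: contraNT; rewrite -ltnNge => poorX; apply: poor_dead.
  rewrite /P /poor poorX andbT; apply/allP => _ /mapP[k kb ->].
  have km := back_lt kb; apply/bigcupP; exists (chi k); last exact: fA.
  by apply: chiP; rewrite ?km //; move: kb; rewrite mem_filter => /andP[].
pose B c l := [set y | dead e (P c) (d - size l) (map (upd f m y) l)].
(* [B c l] is small whenever some [j] with [chi j = c] has [l] as its trace;
   [B'] discards the irrelevant pairs, so that the union bound is over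
   [q * Delta] sets although [j] ranges over up to [n] vertices. *)
pose B' c l := if #|B c l| * 2 ^ e < #|V| then B c l else set0.
pose ls := undup [seq back j m.+1 | j <- iota 0 n & (m < j) && R m j].
pose U := [set f i | i : 'I_m].
pose Bad := \bigcup_(c : 'I_q) \bigcup_(l <- ls) B' c l.
have cardBad : #|Bad| * 2 ^ e <= q * Delta * #|V|.
  apply: (@leq_trans ((\sum_(c : 'I_q) \sum_(l <- ls) #|B' c l|) * 2 ^ e)).
    rewrite leq_mul2r; apply/orP; right.
    apply: leq_trans (leq_card_bigcup _ _) _; apply: leq_sum => c _.
    exact: leq_card_bigcup.
  rewrite -[X in _ <= X * _ * _](card_ord q) -mulnA -sum_nat_const big_distrl /=.
  apply: leq_sum => c _.
  apply: (@leq_trans (size ls * #|V|)); last by rewrite leq_mul2r size_traces ?orbT.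
  have -> : size ls * #|V| = \sum_(l <- ls) #|V|.
    by rewrite big_const_seq count_predT iter_addn_0 mulnC.
  rewrite big_distrl /=.
  apply: leq_sum => l _; rewrite /B'; case: ifP => [/ltnW //|_].
  by rewrite cards0.
have cardU : #|U| <= m by apply: leq_trans (leq_imset_card _ _) _; rewrite card_ord.
have [y] : exists y, y \in (A (chi m) :&: common E X) :\: (U :|: Bad).
  apply/set0Pn; rewrite -card_gt0.
  have : #|(A (chi m) :&: common E X)| <=
     #|(A (chi m) :&: common E X) :\: (U :|: Bad)| + (#|U| + #|Bad|).
    rewrite -(cardsID (U :|: Bad)) addnC leq_add2l.
    by apply: leq_trans (leq_card_setU _ _); apply: subset_leq_card; exact: subsetIr.
  case: #|_ :\: _| => //; rewrite add0n => small.
  have := room; rewrite ltnNge => /negP[].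
  apply: (@leq_trans (#|A (chi m) :&: common E X| * 2 ^ rho * 2 ^ (e - rho))).
    by rewrite leq_mul2r rich orbT.
  rewrite -mulnA -expnD subnKC //.
  apply: (@leq_trans ((#|U| + #|Bad|) * 2 ^ e)); first by rewrite leq_mul2r small orbT.
  rewrite mulnDl; apply: leq_add => //; rewrite leq_mul2r; apply/orP; right.
  exact: leq_trans cardU (ltnW mn).
rewrite !inE negb_or => /andP[/andP[yU yBad] /andP[yA /allP yX]].
exists y; split=> //.
- move=> i im; apply: contraNneq yU => <-.
  by apply/imsetP; exists (Ordinal im).
- move=> i im Rim; rewrite Esym; apply: yX; apply: map_f.
  by rewrite mem_filter Rim mem_iota.
move=> j /andP[mj jn] Rmj; apply: contraNN yBad => deadj.
apply/bigcupP; exists (chi j) => //.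
have jl : back j m.+1 \in ls.
  rewrite mem_undup; apply/mapP; exists j => //.
  by rewrite mem_filter mj Rmj mem_iota.
rewrite (big_rem _ jl) /= inE; apply/orP; left.
(* It remains to see that the discarding test is passed: the tuple of [j] was alive with a slot left
   for [m], so fewer than a [2 ^- e] proportion of the choices of [y] kill it. *)
rewrite /B' ifT ?inE // ltnNge.
have := alive j; rewrite (ltnW mj) jn => /(_ isT).
have lt_s : size (back j m) < d.
  apply: leq_trans (size_back jn).
  by apply: leq_trans (leq_size_back j mj); rewrite backS Rmj size_rcons.
rewrite -(subnSK lt_s) /=; apply: contraNN => /leq_trans; apply.
rewrite mulnC leq_mul2l; apply/orP; right; apply: subset_leq_card.
apply/subsetP => z; rewrite !inE backS Rmj size_rcons map_rcons map_upd_back.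
by rewrite /upd eqxx.
Qed.

Lemma embedding_exists : exists f : nat -> V,
  (forall i j, i < j < n -> f i != f j) /\
  (forall i j, i < j < n -> R i j -> E (f i) (f j)).
Proof.
suff part m : m <= n -> exists f, partial_embedding m f.
  by have [f []] := part n (leqnn n); exists f.
elim: m => [|m IHm] mn.
  have /card_gt0P[v0 _] := V_gt0.
  exists (fun=> v0); split=> [i|i j|i j|j _]; rewrite ?ltn0 ?andbF //= subn0; apply/negP => /dead_count /= hd.
  (* A dead empty tuple would give a [2 ^- (e * d)] proportion of poor [d]-tuples, too many as
     [e * d < b]. *)
  have := fewA (chi j); rewrite /few_poor leqNgt => /negP[].
  rewrite -(ltn_pmul2r (_ : 0 < 2 ^ (e * d))) ?expn_gt0 //.
  apply: (@leq_trans (#|V| ^ d * 2 ^ b)).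
    by rewrite ltn_pmul2l ?expn_gt0 ?V_gt0 // ltn_exp2l.
  by rewrite mulnAC leq_mul2r hd orbT.
have [f pf] := IHm (ltnW mn).
have [y [yA yf yE alive_y]] := embedding_next mn pf.
have [fA finj fE alive] := pf.
exists (upd f m y); split.
- move=> i; rewrite /upd ltnS leq_eqVlt; case: eqP => [->|_] //=; exact: fA.
- move=> i j /andP[ij]; rewrite ltnS leq_eqVlt /upd => /orP[/eqP jm|jm].
    by subst j; rewrite eqxx (ltn_eqF ij) yf.
  by rewrite (ltn_eqF jm) (ltn_eqF (ltn_trans ij jm)) finj ?ij.
- move=> i j /andP[ij]; rewrite ltnS leq_eqVlt /upd => /orP[/eqP jm|jm].
    by subst j; rewrite eqxx (ltn_eqF ij); exact: yE.
  by rewrite (ltn_eqF jm) (ltn_eqF (ltn_trans ij jm)) => Rij; rewrite fE ?ij.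
move=> j /andP[mj jn]; have [Rmj|nRmj] := boolP (R m j).
  by apply: alive_y; rewrite ?mj.
by rewrite backS (negPf nRmj) map_upd_back alive // (ltnW mj).
Qed.

End Embedding.


(** * Embedding a graph along its degenerate ordering *)

Lemma greedy_coloring (n d : nat) (R : rel nat) :
  (forall j, j < n -> size (back R j j) <= d) ->
  exists chi : nat -> 'I_d.+1, forall i j, i < j < n -> R i j -> chi i != chi j.
Proof.
move=> size_back; elim: n size_back => [|n IHn] size_back.
  by exists (fun=> ord0) => i j; rewrite ltn0 andbF.
have [j jn|chi chiP] := IHn; first exact: size_back (ltnW jn).
pose S := [seq chi k | k <- back R n n].
have [c cS] : exists c, c \notin S.
  apply/existsP; apply: contraT; rewrite negb_exists => /forallP allS.
  suff : #|'I_d.+1| <= d by rewrite card_ord ltnn.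
  apply: leq_trans (size_back n (ltnSn n)); rewrite -(size_map chi) cardE.
  apply: uniq_leq_size; first exact: enum_uniq.
  by move=> c _; have := allS c; rewrite negbK.
exists (upd chi n c) => i j /andP[ij]; rewrite ltnS leq_eqVlt /upd => /orP[/eqP jn|jn].
  subst j; rewrite eqxx (ltn_eqF ij) => Rin; apply: contraNneq cS => <-.
  by apply: map_f; rewrite mem_filter Rin mem_iota.
by rewrite (ltn_eqF jn) (ltn_eqF (ltn_trans ij jn)); apply: chiP; rewrite ij.
Qed.

Section Arrows.
Variables (d Delta t : nat) (H : sgraph).
Hypotheses (d_gt0 : 0 < d) (t_gt0 : 0 < t) (H_gt0 : 0 < #|H|).
Hypotheses (Delta_le : Delta <= 2 ^ (t * t)) (degH : dDelta_degenerate d Delta H).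

Lemma nat_ordering : exists (vv : nat -> H) (u : H -> nat),
  [/\ forall i j, i < #|H| -> j < #|H| -> vv i = vv j -> i = j,
      forall x, u x < #|H| /\ vv (u x) = x,
      forall j, j < #|H| -> size (back (fun i j => adj (vv i) (vv j)) j j) <= d &
      forall i, i < #|H| -> size (undup [seq back (fun i j => adj (vv i) (vv j)) j i.+1
        | j <- iota 0 #|H| & (i < j) && adj (vv i) (vv j)]) <= Delta].
Proof.
have [v [[u vK uK] degv]] := degH.
pose vv k := v (insubd (Ordinal H_gt0) k).
have vvE k (kn : k < #|H|) : vv k = v (Ordinal kn).
  by rewrite /vv; congr v; apply: val_inj; rewrite val_insubd kn.
have vv_inj i j : i < #|H| -> j < #|H| -> vv i = vv j -> i = j.
  by move=> i_n jn; rewrite !vvE => /(can_inj vK) [].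
exists vv, u; split=> [|x|j jn|i i_n]; first exact: vv_inj.
- by rewrite ltn_ord vvE -[RHS]uK; split=> //; congr v; apply: val_inj.
- have [degj _] := degv (Ordinal jn); apply: leq_trans degj.
  rewrite -(size_map vv) cardE; apply: uniq_leq_size.
    rewrite map_inj_in_uniq ?filter_uniq ?iota_uniq // => k k' /back_lt kj /back_lt k'j.
    by apply: vv_inj; exact: ltn_trans jn.
  move=> x /mapP[k]; rewrite mem_filter mem_iota => /andP[adjk /= kj] ->.
  have kn := ltn_trans kj jn; rewrite mem_enum; apply/imsetP.
  by exists (Ordinal kn); rewrite ?vvE // inE -!vvE /= kj.
have [_ degi] := degv (Ordinal i_n); apply: leq_trans degi.
set SS := [set S | _].
(* Turns a trace given as a set into its list of indices, so there are no more distinct lists than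
   sets. *)
pose g (S : {set H}) := [seq k <- iota 0 i.+1 | vv k \in S].
rewrite cardE -(size_map g); apply: uniq_leq_size; first exact: undup_uniq.
move=> l; rewrite mem_undup => /mapP[j]; rewrite mem_filter mem_iota.
move=> /andP[/andP[ij adjij] /= jn] ->.
apply/mapP; exists (nbhd (vv j) :&: initial v (Ordinal i_n)).
  rewrite mem_enum inE subsetIr /=; apply/existsP; exists (Ordinal jn).
  by rewrite -!vvE /= ij adjij eqxx.
apply: eq_in_filter => k; rewrite mem_iota /= add0n ltnS => ki.
have kn := leq_ltn_trans ki i_n.
rewrite !inE adj_sym; case: (adj _ _) => //=; apply/esym/imsetP.
by exists (Ordinal kn); rewrite ?vvE // inE.
Qed.

Lemma arrows_dDelta : arrows (2 ^ (depth d.+1 d * t + 2) * #|H|) H.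
Proof.
set N := _ * _; set rho := depth d.+1 d * t.
have [vv [u [vv_inj uP size_back size_traces]]] := nat_ordering.
set R := fun i j => _ in size_back size_traces.
have [chi chiP] := greedy_coloring size_back.
apply/forallP => c; pose col (x y : 'I_N) := c [set x; y].
have colC x y : col x y = col y x by rewrite /col setUC.
have N_gt0 : 0 < N by rewrite /N muln_gt0 expn_gt0.
have V_gt0 : 0 < #|'I_N| by rewrite card_ord.
have [e [A HA]] := @mono_spread d.+1 d t t_gt0 _ col colC V_gt0.
(* Gives [2 * (d.+1 * Delta) <= 2 ^ h]: one unit for the factor 2, [d.+1] for the number of colour
   classes, [t * t] for [Delta]. *)
pose h := d.+2 + t * t.
have lt_bad : (rho + h) * d < 2 * (expo d.+1 d * (t * t)).
  have depth_ge : base d.+1 d <= depth d.+1 d.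
    by rewrite /depth addSn expnS leq_pmulr // expn_gt0 /base; lia.
  have expoE : expo d.+1 d = base d.+1 d * depth d.+1 d.
    by rewrite /expo /depth addSn expnS.
  rewrite expoE /rho /h.
  have : base d.+1 d = 10 * d.+2 + d by [].
  move: depth_ge t_gt0; move: (base _ _) (depth _ _) (t) => B D T; clear.
  move=> BD T_gt0 BE; subst B.
  have h1 : D * T * d <= (10 * d.+2 + d) * D * (T * T) by nia.
  have h2 : (d.+2 + T * T) * d < (10 * d.+2 + d) * D * (T * T).
    apply: (@leq_trans ((10 * d.+2 + d) * (10 * d.+2 + d) * (T * T))); last by nia.
    by nia.
  by rewrite mulnDl mul2n -addnn -addnS; apply: leq_add.
have le_h : 2 * (d.+1 * Delta) <= 2 ^ h.
  rewrite /h addSn expnS leq_mul2l expnD; apply: leq_mul => //.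
  exact: ltnW (ltn_expl _ _).
move: h lt_bad le_h => h lt_bad le_h.
have [|c'|c'||||f [finj fE]] := @embedding_exists _ (colrel col e) d.+1 d rho
  (2 * (expo d.+1 d * (t * t))) (rho + h) A (colrel_sym colC e) V_gt0 _ _ _ _ _
  #|H| Delta R chi chiP size_back size_traces _.
- by [].
- by have [] := HA c'.
- by have [] := HA c'.
- exact: lt_bad.
- exact: leq_addr.
(* The summand 2 in the exponent of [N] makes the used vertices take a quarter of the right-hand
   side of [room]; the bad sets take at most half, by [le_h]. *)
- rewrite card_ord addKn -[N]/(2 ^ (rho + 2) * #|H|) !(expnD _ rho).
  have Y_gt0 : 0 < 2 ^ h * (2 ^ rho * #|H|) by rewrite !muln_gt0 H_gt0 !expn_gt0.
  have := leq_mul (leqnn (2 * (2 ^ rho * #|H|))) le_h.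
  move: Y_gt0; move: (2 ^ h) (2 ^ rho) #|H| => x y z; clear; nia.
apply/existsP; exists e; apply/existsP; exists [ffun x => f (u x)].
have uinj x y : u x = u y -> x = y.
  by move=> uxy; have [_ <-] := uP x; have [_ <-] := uP y; rewrite uxy.
apply/andP; split.
  apply/injectiveP => x y; rewrite !ffunE => fxy.
  have [[xn _] [yn _]] := (uP x, uP y).
  case: (ltngtP (u x) (u y)) => [xy|yx|/uinj//].
    by have := finj (u x) (u y); rewrite xy yn fxy eqxx => /(_ isT).
  by have := finj (u y) (u x); rewrite yx xn fxy eqxx => /(_ isT).
apply/forallP => x; apply/forallP => y; apply/implyP => xy; rewrite !ffunE.
have [[xn vux] [yn vuy]] := (uP x, uP y).
case: (ltngtP (u x) (u y)) => [lt_xy|lt_yx|/uinj eq_xy].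
- by apply: (fE (u x) (u y)); rewrite ?lt_xy // /R vux vuy.
- by rewrite setUC; apply: (fE (u y) (u x)); rewrite ?lt_yx // /R vux vuy adj_sym.
- by rewrite eq_xy adj_irr in xy.
Qed.

End Arrows.

Lemma ramsey_le H N : 0 < N -> arrows N H -> ramsey H <= N.
Proof.
move=> N_gt0 arrN; rewrite /ramsey; case: ex_minnP => m _; apply.
by rewrite N_gt0.
Qed.

(** * Orderings of degenerate graphs *)

(** A vertex of degree at most [d] in the subgraph induced on [W] is placed last, and the rest is
    ordered by induction. *)
Lemma degenerate_ordering d (H : sgraph) (W : {set H}) : degenerate d H ->
  exists2 s : seq H, uniq s /\ s =i W &
    forall s1 x s2, s = s1 ++ x :: s2 -> #|[set y in s1 | adj x y]| <= d.
Proof.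
move=> degH; move: {2}#|W| (erefl #|W|) => m; elim: m W => [|m IHm] W cardW.
  exists [::]; last by case.
  by split=> // x; rewrite (cards0_eq cardW) inE.
pose F x y := [&& adj x y, x \in W & y \in W].
have [||x xW degx] := degH W F.
- split=> [x y|x y /and3P[]//]; rewrite /F adj_sym.
  by case: (x \in W); case: (y \in W).
- by rewrite -card_gt0 cardW.
have [|s [us sW] degs] := IHm (W :\ x).
  by move: cardW; rewrite (cardsD1 x) xW => -[].
exists (rcons s x).
  split=> [|y]; first by rewrite rcons_uniq sW !inE eqxx us.
  by rewrite mem_rcons inE sW !inE; case: eqP => // ->.
move=> s1 z s2; case/lastP: s2 => [|s2 z'].
  rewrite cats1 => /rcons_inj[<- <-]; apply: leq_trans degx.
  apply: subset_leq_card; apply/subsetP => y; rewrite !inE sW !inE /F xW.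
  by move=> /andP[/andP[_ ->] ->].
by rewrite -rcons_cons -rcons_cat => /rcons_inj[/degs].
Qed.

(** Each trace is determined by the later vertex producing it, so the number of vertices bounds the
    number of traces. *)
Lemma degenerate_dDelta d (H : sgraph) :
  degenerate d H -> dDelta_degenerate d #|H| H.
Proof.
move=> degH; have [s [us sT] degs] := degenerate_ordering [set: H] degH.
have size_s : size s = #|H|.
  by rewrite -(card_uniqP us); apply: eq_card => x; rewrite sT inE.
pose v (i : 'I_#|H|) := tnth (in_tuple s) (cast_ord (esym size_s) i).
have vE x0 i : v i = nth x0 s i by rewrite /v (tnth_nth x0).
have v_inj : injective v.
  move=> i j vij; apply/val_inj/eqP; rewrite -(nth_uniq (v i) _ _ us) -?vE ?vij //=.
    by rewrite size_s.
  by rewrite size_s.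
exists v; split; first by apply: inj_card_bij; rewrite ?card_ord.
move=> i; split.
  have := degs (take i s) (v i) (drop i.+1 s).
  rewrite {1}(vE (v i)) -drop_nth ?size_s // cat_take_drop => /(_ erefl).
  apply: leq_trans; apply: subset_leq_card; apply/subsetP => x /imsetP[j].
  rewrite !inE => /andP[ji adjji] ->; rewrite adj_sym adjji andbT.
  rewrite (vE (v i)) -(nth_take _ ji); apply: mem_nth.
  by rewrite size_take size_s ltn_ord.
rewrite -[leqRHS](card_ord #|H|).
apply: leq_trans (leq_imset_card (fun j => nbhd (v j) :&: initial v i) _).
apply: subset_leq_card; apply/subsetP => S; rewrite inE.
move=> /andP[_ /existsP[j /and3P[_ _ /eqP->]]].
exact: imset_f.
Qed.

(** * Passing to real exponents *)

Section LogBound.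
Import Order.TTheory GRing.Theory Num.Theory.
Variable R : realType.
Local Open Scope ring_scope.

(** For the least such [t], minimality gives [t - 1] at most the square root of the logarithm, which
    is itself at least 1 because [m] is at least 2. *)
Lemma sqrt_log_nat (m : nat) : (1 < m)%N ->
  exists t : nat, [/\ (0 < t)%N, (m <= 2 ^ (t * t))%N &
    t%:R <= 2 * Num.sqrt (log2 m%:R) :> R].
Proof.
move=> m_gt1.
have exm : exists t, (m <= 2 ^ (t * t))%N.
  exists m; apply: leq_trans (ltnW (ltn_expl m (ltnSn 1))) _.
  by rewrite leq_exp2l // leq_pmulr // ltnW.
case: (ex_minnP exm) => -[|t] le_m min_t; first by move: le_m; rewrite leqNgt m_gt1.
exists t.+1; split=> //.
have ln2_gt0 : 0 < ln 2 :> R by rewrite ln_gt0 // ltr1n.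
have lt_m : (2 ^ (t * t) <= m)%N.
  by rewrite leqNgt; apply/negP => /ltnW/min_t; rewrite ltnn.
have logE k : (2 ^ k <= m)%N -> k%:R <= log2 m%:R :> R.
  move=> le_k; rewrite /log2 ler_pdivlMr // mulr_natl -lnXn ?ltr0n //.
  by rewrite ler_ln ?posrE ?exprn_gt0 ?ltr0n ?(ltnW m_gt1) // -natrX ler_nat.
have h1 : 1 <= Num.sqrt (log2 m%:R) :> R.
  by rewrite -[leLHS]sqrtr1 ler_wsqrtr // (logE 1%N).
have h2 : t%:R <= Num.sqrt (log2 m%:R) :> R.
  rewrite -[leLHS]ger0_norm // -sqrtr_sqr ler_wsqrtr //.
  by rewrite -natrX expnS expn1 logE.
by rewrite -natr1; lra.
Qed.

Lemma ramsey_powR (H : sgraph) (K t : nat) (x : R) :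
  (0 < #|H|)%N -> (0 < t)%N -> arrows (2 ^ (K * t + 2) * #|H|) H -> t%:R <= 2 * x ->
  (ramsey H)%:R <= 2 `^ ((2 * K.+2)%:R * x) * #|H|%:R.
Proof.
move=> H_gt0 t_gt0 arrH le_t.
have := ramsey_le _ arrH; rewrite muln_gt0 expn_gt0 H_gt0 => /(_ isT) le_r.
(* As [t] is positive, the additive 2 is absorbed into the coefficient of [t]. *)
apply: (@le_trans _ _ (2 ^ (K.+2 * t) * #|H|)%:R).
  rewrite ler_nat (leq_trans le_r) // leq_mul2r leq_exp2l //; apply/orP; right.
  by rewrite -[K.+2]addn2 mulnDl leq_add2l leq_pmulr.
rewrite natrM ler_wpM2r // natrX -powR_mulrn // ler_powR ?ler1n //.
by rewrite !natrM [2%:R * _]mulrC -mulrA ler_wpM2l.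
Qed.

End LogBound.

Theorem theorem1p1 (R : realType) (d : nat) (hd : (0 < d)%N) :
  exists c : R,
    (forall (H : sgraph) (Delta : nat),
        (0 < #|H|)%N -> (1 < Delta)%N -> dDelta_degenerate d Delta H ->
        ((ramsey H)%:R <= 2 `^ (c * Num.sqrt (log2 Delta%:R)) * #|H|%:R)%R) /\
    (forall H : sgraph,
        (0 < #|H|)%N -> degenerate d H ->
        ((ramsey H)%:R <= 2 `^ (c * Num.sqrt (log2 #|H|%:R)) * #|H|%:R)%R).
Proof.
pose K := depth d.+1 d.
exists (2 * K.+2)%:R%R.
have main (H : sgraph) (Delta : nat) : (0 < #|H|)%N -> (1 < Delta)%N ->
    dDelta_degenerate d Delta H ->
    ((ramsey H)%:R <=
       2 `^ ((2 * K.+2)%:R * Num.sqrt (log2 Delta%:R)) * #|H|%:R :> R)%R.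
  move=> H_gt0 Delta_gt1 degH.
  have [t [t_gt0 le_Delta le_t]] := sqrt_log_nat R Delta_gt1.
  exact: ramsey_powR (arrows_dDelta hd t_gt0 H_gt0 le_Delta degH) le_t.
split=> [|H H_gt0 degH]; first exact: main.
(* A single vertex is treated apart, since [main] needs [1 < Delta]; there the logarithm vanishes
   and the bound is exactly 1. *)
have [H_le1|H_gt1] := leqP #|H| 1; last first.
  exact: main (degenerate_dDelta degH).
have H1 : #|H| = 1 by apply/eqP; rewrite eqn_leq H_le1.
rewrite H1 /log2 ln1 GRing.mul0r Num.Theory.sqrtr0 GRing.mulr0 powRr0.
rewrite GRing.mul1r Num.Theory.ler_nat; apply: ramsey_le => //.
have all_eq (x y : H) : y = x by exact: (fintype_le1P H_le1 x y).
apply/forallP => c; apply/existsP; exists true; apply/existsP.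
exists [ffun=> ord0]; apply/andP; split.
  by apply/injectiveP => x y _; exact: all_eq.
by apply/forallP => x; apply/forallP => y; rewrite (all_eq x y) adj_irr.
Qed.
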